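(* For any choice of the precision parameter $\varepsilon\in(0,1)$, the deterministic algorithm Local-Search is $(1/2-\varepsilon)$-addition-robust.
   Context: Addition robustness: let $V=V_{\mathsf{now}}\cup V_{\mathsf{future}}$ (disjoint), $f:2^V\to\mathbb{R}_{\ge0}$ non-negative monotone submodular, cardinality constraint $\kappa$. An algorithm that sees only $V_{\mathsf{now}}$ (and $f$ on its subsets) and outputs a (possibly random) set $\mathcal{A}[V_{\mathsf{now}}]\subseteq V_{\mathsf{now}}$ with $|\mathcal{A}[V_{\mathsf{now}}]|\le\kappa$ is $\alpha$-addition-robust if for every such instance and every $R\subseteq V_{\mathsf{future}}$: $\mathbb{E}[f(\mathcal{A}[V_{\mathsf{now}}]\cup R)]\ge\alpha\max_{S^*\subseteq V_{\mathsf{now}}\cup R,|S^*|\le\kappa}f(S^* )$. Local-Search with precision $\varepsilon>0$, run on $V_{\mathsf{now}}$: let $S$ be the output of the standard greedy algorithm with cardinality $\kappa$ on $V_{\mathsf{now}}$; while there exists $x\in V_{\mathsf{now}}$ with $f(x\mid S)\ge\frac{1+\varepsilon}{\kappa}f(S)$: pick such an $x$, pick $y\in\arg\min_{y\in S}f(y\mid S\setminus\{y\})$, and set $S\gets (S\cup\{x\})\setminus\{y\}$. Return $S$.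
   Formalization: The loop test also requires f(S) > 0: as printed, if f vanishes on all subsets of a nonempty V_now, the test f(x|S) ≥ 0 always holds and the loop never exits; here the greedy solution is returned. Also κ ≥ 1 is assumed, since the algorithm divides by κ. *)

(* Defs.v *)
From HB Require Import structures.
From mathcomp Require Import all_boot all_order all_algebra.

Set Implicit Arguments.
Unset Strict Implicit.
Unset Printing Implicit Defensive.

Import Order.TTheory GRing.Theory Num.Theory.
Local Open Scope ring_scope.

Section SetFunctions.
Variables (R : realFieldType) (V : finType).
Implicit Types (f : {set V} -> R) (S : {set V}) (x : V).

Definition nonneg_fun f := forall S, 0 <= f S.

Definition monotone f := forall A B : {set V}, A \subset B -> f A <= f B.

Definition submodular f :=
  forall A B : {set V}, f (A :|: B) + f (A :&: B) <= f A + f B.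

(* The marginal value f(x | S). *)
Definition marg f x S : R := f (x |: S) - f S.

End SetFunctions.

Section FiniteDistributions.
Variables (R : realFieldType) (A : finType).

Record fdist := FDist {
  pmf :> A -> R;
  pmf_ge0 : forall a, 0 <= pmf a;
  pmf_sum1 : \sum_a pmf a = 1 }.

Definition expectation (d : fdist) (F : A -> R) : R := \sum_a d a * F a.

Definition dirac_pmf (a0 a : A) : R := (a == a0)%:R.

Lemma dirac_pmf_ge0 a0 a : 0 <= dirac_pmf a0 a.
Proof. exact: ler0n. Qed.

Lemma dirac_pmf_sum1 a0 : \sum_a dirac_pmf a0 a = 1.
Proof.
rewrite (bigD1 a0) //= big1 ?addr0 /dirac_pmf ?eqxx // => a.
by move/negbTE->.
Qed.

Definition dirac (a0 : A) : fdist :=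
  FDist (dirac_pmf_ge0 a0) (dirac_pmf_sum1 a0).

End FiniteDistributions.

(* The ground set is V = N + F, the disjoint union of V_now = N and           *)
(* V_future = F.  An algorithm is handed only N, the values of f on subsets   *)
(* of N, and kappa, and returns a random subset of N; so neither its inputs   *)
(* nor its output can involve V_future.                                       *)
Definition algorithm (R : realFieldType) :=
  forall N : finType, ({set N} -> R) -> nat -> fdist R {set N}.

Definition det_algorithm (R : realFieldType) :=
  forall N : finType, ({set N} -> R) -> nat -> {set N}.

Definition of_det (R : realFieldType) (A : det_algorithm R) : algorithm R :=
  fun N g kappa => dirac R (A N g kappa).

Section AdditionRobustness.
Variable R : realFieldType.

Definition now_set (N F : finType) (S : {set N}) : {set N + F} :=
  [set inl x | x in S].

Definition future_set (N F : finType) (Q : {set F}) : {set N + F} :=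
  [set inr x | x in Q].

Definition restrict_now (N F : finType) (f : {set N + F} -> R) : {set N} -> R :=
  fun S => f (now_set F S).

(* The maximum is over a family containing set0, and f is non-negative in     *)
(* every use, so the default value 0 is harmless.                             *)
Definition opt (N F : finType) (f : {set N + F} -> R) (kappa : nat)
    (Q : {set F}) : R :=
  \big[Num.max/0]_(S : {set N + F} |
      (S \subset now_set F [set: N] :|: future_set N Q) && (#|S| <= kappa)%N)
    f S.

Definition addition_robust (alpha : R) (A : algorithm R) : Prop :=
  forall (N F : finType) (f : {set N + F} -> R) (kappa : nat),
    nonneg_fun f -> monotone f -> submodular f -> (0 < kappa)%N ->
    let out := A N (restrict_now f) kappa in
    (forall S : {set N}, out S != 0 -> (#|S| <= kappa)%N) /\
    (forall Q : {set F},
       expectation out (fun S => f (now_set F S :|: future_set N Q))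
         >= alpha * opt f kappa Q).

End AdditionRobustness.

Section LocalSearch.
Variables (R : realFieldType) (N : finType).
Variables (eps : R) (kappa : nat) (f : {set N} -> R).
Implicit Types (S : {set N}) (x y z : N).

(* [greedy k S]: S may result from k greedy iterations, ties being broken     *)
(* arbitrarily.                                                               *)
Inductive greedy : nat -> {set N} -> Prop :=
| Greedy0 : greedy 0 set0
| GreedyS k S x :
    greedy k S -> x \notin S ->
    (forall z, z \notin S -> marg f z S <= marg f x S) ->
    greedy k.+1 (x |: S).

Definition greedy_output S := greedy (minn kappa #|N|) S.

(* The conjunct 0 < f S matters only when f S = 0.  Without it, the test      *)
(* would then read 0 <= f(x | S) and hold for every x by monotonicity, so     *)
(* the loop would never exit when f vanishes on all subsets of a nonempty     *)
(* V_now.                                                                     *)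
Definition improving S x : bool :=
  (0 < f S) && (marg f x S >= (1 + eps) / kappa%:R * f S).

Definition swap_step S S' : Prop :=
  exists x y : N,
    [/\ improving S x,
        y \in S,
        forall z, z \in S -> marg f y (S :\ y) <= marg f z (S :\ z)
      & S' = (x |: S) :\ y].

(* The sets that the variable S may hold when the loop test is evaluated.     *)
Inductive local_search_run : {set N} -> Prop :=
| LSStart S : greedy_output S -> local_search_run S
| LSStep S S' : local_search_run S -> swap_step S S' -> local_search_run S'.

Definition local_search_output S : Prop :=
  local_search_run S /\ ~ (exists x, improving S x).

End LocalSearch.

(* No run of the loop is infinite, however ties are broken. *)
Definition local_search_terminates (R : realFieldType) (eps : R) : Prop :=
  forall (N : finType) (f : {set N} -> R) (kappa : nat),
    nonneg_fun f -> monotone f -> submodular f -> (0 < kappa)%N ->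
    forall S, greedy_output kappa f S ->
      Acc (fun S2 S1 => swap_step eps kappa f S1 S2) S.

(* A is Local-Search with precision eps, under some tie-breaking rule. *)
Definition is_local_search (R : realFieldType) (eps : R)
    (A : det_algorithm R) : Prop :=
  forall (N : finType) (f : {set N} -> R) (kappa : nat),
    nonneg_fun f -> monotone f -> submodular f -> (0 < kappa)%N ->
    local_search_output eps kappa f (A N f kappa).

(* Main.v *)
Require Import Defs.
From HB Require Import structures.
From mathcomp Require Import all_boot all_order all_algebra.
From mathcomp Require Import ring lra.

Import Order.TTheory GRing.Theory Num.Theory.
Local Open Scope ring_scope.

(** Let [S] be a set of size [kappa].  By submodularity the marginals
    [f(z | S \ z)], [z] in [S], add up to at most [f(S)], so the cheapest one
    is at most [f(S) / kappa]; exchanging it against an [x] with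
    [f(x | S) >= (1 + eps) / kappa * f(S)] multiplies [f(S)] by at least
    [1 + eps / kappa].  Hence the loop stops, at a set [S] all of whose
    marginals are at most [(1 + eps) / kappa * f(S)].  For an optimal set [O],
    [f(O) <= f(S + Q) + \sum_(x in O, x now) f(x | S) <= (2 + eps) f(S + Q)],
    and [1 / (2 + eps) >= 1 / 2 - eps].

    If the final value [f(S)] is [0], no exchange took place; then the first
    greedy choice has value [0], so all singletons and all marginals
    are null. *)

(** * Marginals of monotone submodular functions *)

Section Submodularity.
Set Implicit Arguments.
Unset Strict Implicit.
Variables (R : realFieldType) (V : finType) (f : {set V} -> R).
Hypotheses (f_mono : monotone f) (f_submod : submodular f).
Implicit Types (A B S : {set V}) (x y z : V).

Lemma marg_ge0 x S : 0 <= marg f x S.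
Proof. by rewrite subr_ge0 f_mono ?subsetU1. Qed.

Lemma marg_in x S : x \in S -> marg f x S = 0.
Proof. by move=> xS; rewrite /marg (setUidPr _) ?sub1set ?subrr. Qed.

(** For [x] outside [B], the sets [x |: A] and [B] meet exactly in [A], and submodularity for this
    pair is the claim. *)
Lemma marg_antitone x A B : A \subset B -> marg f x B <= marg f x A.
Proof.
move=> sAB; have [xB|xB] := boolP (x \in B).
  by rewrite marg_in // marg_ge0.
have := f_submod (x |: A) B; rewrite -setUA (setUidPr sAB).
have -> : (x |: A) :&: B = A.
  by rewrite setIUl (setIidPl sAB) (disjoint_setI0 _) ?set0U // disjoints1.
rewrite /marg; lra.
Qed.

(** Insert the elements of [B] one at a time: each gains at most its marginal over the smaller set
    [A]. *)
Lemma le_sum_marg A B : f (A :|: B) <= f A + \sum_(x in B) marg f x A.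
Proof.
have [n] := ubnP #|B|; elim: n B => // n IHn B; rewrite ltnS => leBn.
have [->|[x xB]] := set_0Vmem B; first by rewrite setU0 big_set0 addr0.
rewrite (big_setD1 x xB) /=.
have /IHn IH : (#|B :\ x| < n)%N by rewrite (cardsD1 x B) xB in leBn.
have := marg_antitone x (subsetUl A (B :\ x)).
by rewrite {1}/marg setUCA setD1K //; lra.
Qed.

Lemma sum_marg_setD1_le S : \sum_(z in S) marg f z (S :\ z) <= f S - f set0.
Proof.
(* Only the range of summation shrinks to [T]; the marginals stay relative to [S]. Each is at most
   the loss from deleting [x] from [T], and these losses telescope. *)
suff H n (T : {set V}) : (#|T| < n)%N -> T \subset S ->
    \sum_(z in T) marg f z (S :\ z) <= f T - f set0 by exact: H (ltnSn _) _.
elim: n T => // n IHn T; rewrite ltnS => leTn sTS.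
have [->|[x xT]] := set_0Vmem T; first by rewrite big_set0 subrr.
rewrite (big_setD1 x xT) /=.
have ltTn : (#|T :\ x| < n)%N by rewrite (cardsD1 x T) xT in leTn.
have := IHn _ ltTn (subset_trans (subD1set T x) sTS).
have := marg_antitone x (setSD [set x] sTS).
by rewrite {2}/marg setD1K //; lra.
Qed.

End Submodularity.

(** * Progress, termination and exit condition of the loop *)

Section LocalSearch.
Set Implicit Arguments.
Unset Strict Implicit.
Variables (R : realFieldType) (N : finType) (eps : R) (kappa : nat).
Variable f : {set N} -> R.
Hypotheses (eps_gt0 : 0 < eps) (kappa_gt0 : (0 < kappa)%N).
Hypotheses (f_ge0 : nonneg_fun f) (f_mono : monotone f).
Hypothesis f_submod : submodular f.
Implicit Types (S T : {set N}) (x y z : N).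

Local Notation run := (local_search_run eps kappa f).
Local Notation size_bound := (minn kappa #|N|).

Lemma greedy_card k S : greedy f k S -> #|S| = k.
Proof. by elim=> [|{}k {}S x _ IH xS _]; rewrite ?cards0 // cardsU1 xS IH. Qed.

Lemma improving_notin S x : improving eps kappa f S x -> x \notin S.
Proof.
case/andP=> fS_gt0; apply: contraTN => xS; rewrite marg_in // -ltNge.
by rewrite mulr_gt0 // divr_gt0 ?ltr0n // ltr_wpDl ?ler01.
Qed.

(** If [kappa] exceeded the size of [N], then [S] would be all of [N], leaving no room for an
    improving element. *)
Lemma improving_card S x :
  #|S| = size_bound -> improving eps kappa f S x -> #|S| = kappa.
Proof.
move=> cardS /improving_notin xS; rewrite cardS; apply/minn_idPl.
rewrite leqNgt; apply/negP => lt_N_kappa; move: xS.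
suff /eqP-> : S == [set: N] by rewrite inE.
by rewrite eqEcard subsetT cardsT cardS leq_min leqnn ltnW.
Qed.

Lemma swap_card S S' :
  #|S| = size_bound -> swap_step eps kappa f S S' -> #|S'| = size_bound.
Proof.
move=> <- [x [y [/improving_notin xS yS _ ->]]].
have := cardsD1 y (x |: S).
by rewrite !inE yS orbT cardsU1 xS !add1n => /eqP; rewrite eqSS => /eqP.
Qed.

Lemma swap_lt S S' :
  #|S| = size_bound -> swap_step eps kappa f S S' -> f S < f S'.
Proof.
move=> cardS [x [y [imprx yS y_min ->]]].
have xS := improving_notin imprx.
have cardSk := improving_card cardS imprx.
case/andP: imprx => fS_gt0 marg_x.
have k_gt0 : 0 < kappa%:R :> R by rewrite ltr0n.
(* Averaging: the smallest of the [kappa] removal losses is at most their mean. *)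
have marg_y : marg f y (S :\ y) * kappa%:R <= f S.
  rewrite -cardSk mulr_natr -sumr_const.
  apply: (@le_trans _ _ (\sum_(z in S) marg f z (S :\ z))).
    exact: ler_sum.
  have := sum_marg_setD1_le f_mono f_submod S; have := f_ge0 set0; lra.
(* With [x] already added, removing [y] costs no more than before. *)
have : marg f y ((x |: S) :\ y) <= marg f y (S :\ y).
  by apply: marg_antitone => //; rewrite setSD ?subsetU1.
rewrite {1}/marg setD1K ?inE ?yS ?orbT //.
move: marg_y; rewrite -ler_pdivlMr // => marg_y.
have : 0 < eps / kappa%:R * f S by rewrite mulr_gt0 ?divr_gt0.
move: marg_x; rewrite {1}/marg !mulrDl mul1r [_^-1 * f S]mulrC; lra.
Qed.

(** A termination measure in [nat]: the values lie in an arbitrary ordered field, but only finitely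
    many sets can beat [S], and [S'] stops being one of them. *)
Lemma swap_superlevel_card S S' :
  #|S| = size_bound -> swap_step eps kappa f S S' ->
  (#|[set T | (f S' < f T)%R]| < #|[set T | (f S < f T)%R]|)%N.
Proof.
move=> cardS /(swap_lt cardS) ltSS'; apply: proper_card.
apply/properP; split; last by exists S'; rewrite !inE ?ltxx.
by apply/subsetP=> T; rewrite !inE; apply: lt_trans.
Qed.

Lemma swap_acc S :
  #|S| = size_bound -> Acc (fun S2 S1 => swap_step eps kappa f S1 S2) S.
Proof.
have [n] := ubnP #|[set T | (f S < f T)%R]|; elim: n S => [|n IHn] S.
  by rewrite ltn0.
rewrite ltnS => leSn cardS; constructor=> S' swapS.
apply: IHn (swap_card cardS swapS).
exact: leq_trans (swap_superlevel_card cardS swapS) leSn.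
Qed.

Lemma local_search_run_card S : run S -> #|S| = size_bound.
Proof. by elim=> [{}S /greedy_card //|{}S S' _]; apply: swap_card. Qed.

(** The witness is the first greedy choice, made over [set0]; later iterations only add elements. *)
Lemma greedy_first k S :
  greedy f k.+1 S -> exists2 x, x \in S & forall z, f [set z] <= f [set x].
Proof.
move: {-1}k.+1 (erefl k.+1) => m def_m greedyS.
elim: greedyS k def_m => // {m}m {}S x greedyS IH xS x_max k _.
case: m greedyS IH => [greedy0|m _ /(_ m erefl)[y yS y_max]]; last first.
  by exists y; rewrite // !inE yS orbT.
have S0 : S = set0 by apply/eqP; rewrite -cards_eq0 (greedy_card greedy0).
exists x => [|z]; first by rewrite setU11.
by have := x_max z; rewrite S0 inE /marg !setU0 => /(_ isT); lra.
Qed.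

Lemma greedy_null S x :
  greedy_output kappa f S -> f S = 0 -> marg f x S = 0.
Proof.
rewrite /greedy_output => greedyS fS0.
have : (0 < size_bound)%N.
  by rewrite leq_min kappa_gt0; apply/card_gt0P; exists x.
case def_k: size_bound greedyS => [|k] // /greedy_first[y yS y_max] _.
have fy_le0 : f [set y] <= 0 by rewrite -fS0 f_mono ?sub1set.
apply/le_anti; rewrite marg_ge0 // andbT.
apply: le_trans (marg_antitone f_mono f_submod x (sub0set S)) _.
rewrite /marg setU0; have := y_max x; have := f_ge0 set0; lra.
Qed.

Lemma output_marg_le S x :
  local_search_output eps kappa f S ->
  marg f x S <= (1 + eps) / kappa%:R * f S.
Proof.
case=> runS no_impr.
have [fS_gt0|] := ltrP 0 (f S).
  rewrite leNgt; apply/negP => /ltW marg_x.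
  by apply: no_impr; exists x; rewrite /improving fS_gt0.
move=> fS_le0; have fS0 : f S = 0 by apply/le_anti; rewrite fS_le0 f_ge0.
case: runS fS0 {no_impr fS_le0} => [{}S greedyS fS0|T {}S runT swapT fS0].
  by rewrite greedy_null // fS0 mulr0.
(* A swap would have raised the value strictly above [f T], which is nonnegative. *)
have := swap_lt (local_search_run_card runT) swapT.
by rewrite fS0 ltNge f_ge0.
Qed.

(** * A deterministic implementation of the search *)

Definition greedy_step S : {set N} :=
  if [pick z | z \notin S] is Some z0
  then [arg max_(z > z0 | z \notin S) marg f z S]%O |: S else S.

Definition local_search_step S : {set N} :=
  if [pick x | improving eps kappa f S x] is Some x then
    if [pick y in S] is Some y0
    then (x |: S) :\ [arg min_(y < y0 | y \in S) marg f y (S :\ y)]%O else S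
  else S.

(** The number of all subsets bounds the number of swaps; the surplus iterations leave the set
    fixed. *)
Definition local_search_set : {set N} :=
  iter #|[set: {set N}]| local_search_step (iter size_bound greedy_step set0).

Lemma iter_greedy_step k :
  (k <= #|N|)%N -> greedy f k (iter k greedy_step set0).
Proof.
elim: k => [|k IHk] ltkN /=; first exact: Greedy0.
have {IHk} greedyS := IHk (ltnW ltkN); move: (iter _ _ _) greedyS => S greedyS.
rewrite /greedy_step; case: pickP => [z0 z0S|allS]; last first.
  move: ltkN; rewrite -(greedy_card greedyS) -cardsT ltnNge.
  by rewrite subset_leq_card //; apply/subsetP=> z _; have /negbFE := allS z.
by case: arg_maxP => // x xS x_max; apply: GreedyS greedyS xS x_max.
Qed.

Lemma local_search_stepP S :
  run S ->
  swap_step eps kappa f S (local_search_step S) \/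
  local_search_step S = S /\ local_search_output eps kappa f S.
Proof.
move=> runS; rewrite /local_search_step; case: pickP => [x imprx|no_impr].
  left; have cardS := improving_card (local_search_run_card runS) imprx.
  case: pickP => [y0 y0S|S0]; last by move: kappa_gt0; rewrite -cardS eq_card0.
  by case: arg_minP => // y yS y_min; exists x, y.
by right; split=> //; split=> // -[x]; rewrite no_impr.
Qed.

Lemma iter_local_search_step n S :
  run S -> (#|[set T | (f S < f T)%R]| <= n)%N ->
  local_search_output eps kappa f (iter n local_search_step S).
Proof.
elim: n S => [|n IHn] S runS leSn; last rewrite iterSr.
  (* With no set of larger value left, a swap is impossible. *)
  case: (local_search_stepP runS) => [swapS|[_ //]].
  have := swap_superlevel_card (local_search_run_card runS) swapS.
  by rewrite ltnNge (leq_trans leSn).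
case: (local_search_stepP runS) => [swapS|[stepS outS]].
  apply: IHn (LSStep runS swapS) _; rewrite -ltnS; apply: leq_trans leSn.
  exact: swap_superlevel_card (local_search_run_card runS) swapS.
by rewrite stepS; elim: {IHn leSn}n => //= n; rewrite -iterS iterSr stepS.
Qed.

Lemma local_search_setP : local_search_output eps kappa f local_search_set.
Proof.
apply: iter_local_search_step; last by rewrite subset_leq_card ?subsetT.
by apply/LSStart/iter_greedy_step; rewrite geq_minr.
Qed.

End LocalSearch.

(** * From [N] to the whole ground set [N + F] *)

Section RestrictNow.
Set Implicit Arguments.
Unset Strict Implicit.
Variables (R : realFieldType) (N F : finType) (f : {set N + F} -> R).

Lemma restrict_now_nonneg : nonneg_fun f -> nonneg_fun (restrict_now f).
Proof. by move=> f_ge0 S; apply: f_ge0. Qed.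

Lemma restrict_now_monotone : monotone f -> monotone (restrict_now f).
Proof. by move=> f_mono A B sAB; apply/f_mono/imsetS. Qed.

Lemma restrict_now_submodular : submodular f -> submodular (restrict_now f).
Proof.
move=> f_submod A B; rewrite /restrict_now /now_set imsetU imsetI.
  exact: f_submod.
by move=> x y _ _ [].
Qed.

Lemma restrict_now_marg x (S : {set N}) :
  marg (restrict_now f) x S = marg f (inl x) (now_set F S).
Proof. by rewrite /marg /restrict_now /now_set imsetU1. Qed.

Lemma opt_ge0 kappa (Q : {set F}) : nonneg_fun f -> 0 <= opt f kappa Q.
Proof.
move=> f_ge0.
by rewrite /opt; elim/big_ind: _ => // a b a_ge0 _; rewrite le_max a_ge0.
Qed.

Lemma opt_le kappa (c : R) (S : {set N}) (Q : {set F}) :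
    nonneg_fun f -> monotone f -> submodular f -> 0 <= c ->
    (forall x, marg (restrict_now f) x S <= c) ->
  opt f kappa Q <= f (now_set F S :|: future_set N Q) + kappa%:R * c.
Proof.
move=> f_ge0 f_mono f_submod c_ge0 marg_c.
set SQ := _ :|: _; rewrite /opt.
elim/big_ind: _ => [|a b a_le b_le|O /andP[sO cardO]].
- by rewrite addr_ge0 ?mulr_ge0 ?ler0n.
- by rewrite ge_max a_le.
(* The future elements of [O] lie in [Q], hence in [SQ], so only its present elements contribute
   marginals. *)
pose O' : {set N} := [set x | inl x \in O].
have cardO' : (#|O'| <= kappa)%N.
  rewrite -(card_imset O' (@inl_inj N F)); apply: leq_trans cardO.
  by apply/subset_leq_card/subsetP=> _ /imsetP[x xO ->]; rewrite inE in xO.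
have sOSQ : O \subset SQ :|: now_set F O'.
  apply/subsetP=> -[x|q] in_O; rewrite !inE.
    by rewrite orbC imset_f // inE.
  have := subsetP sO _ in_O; rewrite inE => /orP[/imsetP[]//|->].
  by rewrite orbT.
apply: le_trans (f_mono _ _ sOSQ) _.
apply: le_trans (le_sum_marg f_mono f_submod _ _) _; rewrite lerD2l.
rewrite big_imset /=; last by move=> x y _ _ [].
apply: le_trans (_ : \sum_(x in O') c <= _); last first.
  by rewrite sumr_const -[c *+ _]mulr_natl ler_wpM2r ?ler_nat.
apply: ler_sum => x _; apply: le_trans (marg_c x).
by rewrite restrict_now_marg marg_antitone ?subsetUl.
Qed.

End RestrictNow.

(** * The approximation ratio *)

Lemma expectation_dirac (R : realFieldType) (T : finType) (a0 : T)
    (G : T -> R) :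
  expectation (dirac R a0) G = G a0.
Proof.
rewrite /expectation (bigD1 a0) //= big1 => [|a /negbTE neq_a].
  by rewrite /dirac_pmf eqxx mul1r addr0.
by rewrite /dirac_pmf neq_a mul0r.
Qed.

(** For [eps < 1 / 2], use [(1 / 2 - eps) * (2 + eps) = 1 - (3 / 2 + eps) * eps <= 1]; otherwise the
    left side is nonpositive. *)
Lemma robustness_bound (R : realFieldType) (eps o v : R) :
  0 < eps -> 0 <= v -> 0 <= o -> o <= (2 + eps) * v -> (1 / 2 - eps) * o <= v.
Proof.
move=> eps_gt0 v_ge0 o_ge0 o_le_v; have [half_le|half_gt] := lerP (1 / 2) eps.
  by apply: (@le_trans _ _ 0) => //; rewrite mulr_le0_ge0 ?subr_le0.
have : (1 / 2 - eps) * o <= (1 / 2 - eps) * ((2 + eps) * v).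
  by rewrite ler_wpM2l //; lra.
have : 0 <= (3 / 2 + eps) * eps * v by rewrite !mulr_ge0 //; lra.
have -> : (1 / 2 - eps) * ((2 + eps) * v) = v - (3 / 2 + eps) * eps * v.
  by field.
lra.
Qed.

Theorem theorem8 (R : realFieldType) (eps : R) (heps : 0 < eps < 1) :
  [/\ local_search_terminates eps,
      exists A : det_algorithm R, is_local_search eps A
    & forall A : det_algorithm R, is_local_search eps A ->
        addition_robust (1 / 2 - eps) (of_det A)].
Proof.
have eps_gt0 : 0 < eps by case/andP: heps.
split.
- move=> N f kappa f_ge0 f_mono f_submod k_gt0 S greedyS.
  by apply: swap_acc => //; apply: greedy_card greedyS.
- exists (fun N f kappa => local_search_set eps kappa f).
  by move=> N f kappa *; apply: local_search_setP.
move=> A A_ls N F f kappa f_ge0 f_mono f_submod k_gt0 out.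
have g_ge0 := restrict_now_nonneg f_ge0.
have g_mono := restrict_now_monotone f_mono.
have g_submod := restrict_now_submodular f_submod.
have outP := A_ls N _ kappa g_ge0 g_mono g_submod k_gt0.
split=> [S|Q].
  rewrite /= /dirac_pmf pnatr_eq0 eqb0 negbK => /eqP->.
  by rewrite (local_search_run_card eps_gt0 k_gt0 outP.1) geq_minl.
rewrite expectation_dirac.
set S := A _ _ _ in outP *.
have marg_S x := output_marg_le eps_gt0 k_gt0 g_ge0 g_mono g_submod x outP.
have fS_ge0 := g_ge0 S.
have k_gt0' : 0 < kappa%:R :> R by rewrite ltr0n.
have c_ge0 : 0 <= (1 + eps) / kappa%:R * restrict_now f S.
  by rewrite mulr_ge0 ?divr_ge0 // ?ler0n //; lra.
have := opt_le kappa Q f_ge0 f_mono f_submod c_ge0 marg_S.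
(* The factor [kappa] cancels, so the marginals add at most [(1 + eps) * f(S)]. *)
rewrite mulrA [_ * (_ / _)]mulrC divfK ?gt_eqF //.
have : restrict_now f S <= f (now_set F S :|: future_set N Q).
  by rewrite f_mono ?subsetUl.
set v := f (_ :|: _); set o := opt _ _ _ => fS_le o_le.
have o_le_v : o <= (2 + eps) * v by nra.
exact: robustness_bound eps_gt0 (f_ge0 _) (opt_ge0 _ _ f_ge0) o_le_v.
Qed.
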